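(* Let $e\ge1$ and let $(V,\mathcal B_r)$ be a combinatorial $2e$-$(n,r,\lambda_{2e})$ design with $r\neq n-r$, and let $(V,\mathcal B_{n-r})$ be its complementary design, $\mathcal B_{n-r}=\{V\setminus B: B\in\mathcal B_r\}$. Let $\mathcal B=\mathcal B_r\cup\mathcal B_{n-r}$ and let $Y=Y_r\cup Y_{n-r}$ be the subset of $X$ on the two shells $X_r\cup X_{n-r}$ of $H(n,2)$ corresponding to the block set $\mathcal B$, i.e. $Y=\{x\in X: B_x\in\mathcal B\}$. Then $(Y,w)$ is a relative $(2e+1)$-design (with respect to $u_0$) with constant weight, namely with $w(y)=w$ for all $y\in Y$, where $w>0$ is a constant.
   Context: Let $V=\{1,\dots,n\}$, let $X=\{0,1\}^n$ be the point set of the binary Hamming scheme $H(n,2)$, $u_0=(0,\dots,0)$, and let the shell $X_r$ be the set of vectors in $X$ with exactly $r$ ones. For $x\in X$ put $B_x=\{i\in V: x_i=1\}$. If $Y\subset X_{r_1}\cup\dots\cup X_{r_p}$ with distinct $r_\nu$ and $w:Y\to\mathbb R_{>0}$, put $Y_{r_\nu}=Y\cap X_{r_\nu}$ and $w(Y_{r_\nu})=\sum_{y\in Y_{r_\nu}}w(y)$; then $(Y,w)$ is a relative $t$-design with respect to $u_0$ if for every $1\le j\le t$ and every $z\in X_j$ (with $X_j=\emptyset$ if $j>n$) $$\sum_{\nu=1}^p\frac{w(Y_{r_\nu})}{|X_{r_\nu}|}\sum_{x\in X_{r_\nu}}f_z(x)=\sum_{y\in Y}w(y)f_z(y),$$ where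 $f_z(x)=1$ if $B_z\subset B_x$ and $f_z(x)=0$ otherwise. (This is the definition via the P-structure; for $H(n,2)$ it coincides with the one via the Q-structure.) A combinatorial $s$-$(n,k,\lambda)$ design, $s\le k\le n$, is a pair $(V,\mathcal B)$ with $|V|=n$ and $\mathcal B$ a set of $k$-element subsets of $V$ such that every $s$-element subset of $V$ is contained in exactly $\lambda$ blocks. *)

(* Defs.v *)
From mathcomp Require Import all_boot all_order all_algebra.
From mathcomp Require Import reals.

Set Implicit Arguments.
Unset Strict Implicit.
Unset Printing Implicit Defensive.

Import Order.TTheory GRing.Theory Num.Theory.

Local Open Scope ring_scope.

Definition combinatorial_design (V : finType) (s n k lam : nat)
    (Bs : {set {set V}}) : Prop :=
  [/\ #|V| = n,
      (s <= k <= n)%N,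
      (forall B : {set V}, B \in Bs -> #|B| = k)
    & (forall S : {set V}, #|S| = s ->
         #|[set B in Bs | S \subset B]| = lam)].

Definition complementary_blocks (V : finType) (Bs : {set {set V}}) :
  {set {set V}} := [set ~: B | B in Bs].

Definition hamming_point (n : nat) : finType := {ffun 'I_n -> bool}.

(* The set written B_x in the literature. *)
Definition ones (n : nat) (x : hamming_point n) : {set 'I_n} := [set i | x i].

(* Vectors at Hamming distance r from the base point u_0 = (0, ..., 0); this
   is set0 when n < r. *)
Definition shell (n r : nat) : {set hamming_point n} :=
  [set x | #|ones x| == r].

Definition zeta (R : realType) (n : nat) (z x : hamming_point n) : R :=
  (ones z \subset ones x)%:R.

(* [rs] lists the radii r_1, ..., r_p of the shells around u_0 that carry Y.
   Only the values of the weight [w] on Y matter. *)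
Definition relative_design (R : realType) (n t : nat) (rs : seq nat)
    (Y : {set hamming_point n}) (w : hamming_point n -> R) : Prop :=
  [/\ uniq rs /\ {in rs, forall r, (r <= n)%N},
      Y \subset \bigcup_(r <- rs) shell n r,
      {in Y, forall y, 0 < w y}
    & forall (j : nat) (z : hamming_point n),
        (1 <= j <= t)%N -> z \in shell n j ->
        \sum_(r <- rs)
           (\sum_(y in Y :&: shell n r) w y) / #|shell n r|%:R
             * (\sum_(x in shell n r) zeta R z x)
        = \sum_(y in Y) w y * zeta R z y].

Definition points_of_blocks (n : nat) (Bs : {set {set 'I_n}}) :
  {set hamming_point n} := [set x | ones x \in Bs].

(* Main.v *)
(** Subtract from the indicator of the blocks of an s-design the constant
    density of the blocks among all k-subsets.  The resulting function [h] on
    k-subsets has vanishing sums H(S) over the supersets of every S with at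
    most s points.  By inclusion-exclusion, the sum of [h] over the sets
    containing Z plus the sum over the sets disjoint from Z is an alternating
    sum of the H(S), S a subset of Z, in which the coefficient of H(Z) is
    1 + (-1)^|Z|.  For s = 2e this coefficient vanishes when |Z| = s + 1, so
    passing to the blocks together with their complements gains one unit of
    strength. *)
Require Import Defs.
From mathcomp Require Import all_boot all_order all_algebra.
From mathcomp Require Import reals.

Import Order.TTheory GRing.Theory Num.Theory.

Local Open Scope ring_scope.

(** Taking the union with [A] maps the subsets of [B :\: A] of size [s - #|A|] bijectively onto the
    sets counted. *)
Lemma card_draws_between (T : finType) (A B : {set T}) (s : nat) :
  A \subset B -> (#|A| <= s)%N ->
  #|[set S : {set T} | [&& A \subset S, S \subset B & #|S| == s]]|
  = 'C(#|B| - #|A|, s - #|A|).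
Proof.
move=> sAB leAs; rewrite -[X in (X - _)%N](cardsID A B) (setIidPr sAB) addKn -cards_draws.
have dA (U : {set T}) : U \subset B :\: A -> [disjoint A & U].
  by rewrite subsetD disjoint_sym => /andP[].
have injA : {in [set U : {set T} | U \subset B :\: A & #|U| == (s - #|A|)%N] &,
             injective (fun U : {set T} => A :|: U)}.
  move=> U W; rewrite !inE => /andP[/dA dU _] /andP[/dA dW _].
  move/(congr1 (fun X => X :\: A)).
  rewrite !setDUl !setDv !set0U.
  by move: dU dW; rewrite ![[disjoint A & _]]disjoint_sym => /setDidPl-> /setDidPl->.
rewrite -[RHS](card_in_imset injA); congr #|pred_of_set _|; apply/setP => S.
rewrite !inE; apply/and3P/imsetP => [[sAS sSB /eqP cS]|[U]].
  exists (S :\: A).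
    by rewrite inE setSD //= cardsD (setIidPr sAS) cS.
  by rewrite setDE setUIr setUCr setIT; apply/esym/setUidPr.
rewrite inE => /andP[sU /eqP cU] ->; split; first exact: subsetUl.
  by rewrite subUset sAB; move: sU; rewrite subsetD => /andP[].
by rewrite cardsU (disjoint_setI0 (dA _ sU)) cards0 subn0 cU subnKC.
Qed.

Section SupersetSums.

Variables (R : numFieldType) (T : finType) (s k : nat) (h : {set T} -> R).
Hypothesis hk : forall B : {set T}, #|B| != k -> h B = 0.

(** After exchanging the sums, each [B] containing [S0] is counted once per intermediate [S]. As [h]
    lives on [k]-sets, this multiplicity is the same for every [B] that contributes. *)
Lemma superset_sum_double_count (S0 : {set T}) :
  (#|S0| <= s)%N ->
  \sum_(S : {set T} | (S0 \subset S) && (#|S| == s))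
     \sum_(B : {set T} | S \subset B) h B
  = 'C(k - #|S0|, s - #|S0|)%:R * \sum_(B : {set T} | S0 \subset B) h B.
Proof.
move=> le0; rewrite (exchange_big_dep (fun B : {set T} => S0 \subset B)) /=; last first.
  by move=> S B /andP[s0 _] /(subset_trans s0).
rewrite mulr_sumr; apply: eq_bigr => B s0B.
have [cB|/hk ->] := eqVneq #|B| k; last by rewrite mulr0 big1.
rewrite sumr_const -[LHS]mulr_natl -cB -(card_draws_between _ _ _ s s0B le0).
congr (_%:R * _); apply: eq_card => S.
by rewrite !inE /in_mem /= -andbA [(_ == s) && _]andbC.
Qed.

(** Double counting from the empty set gives [kappa * 'C(#|T|, s) = 0], because the total of [h] is
    zero; hence [kappa = 0]. Double counting from [S0] then gives zero as a nonzero binomial times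
    the desired sum. *)
Lemma superset_sum_eq0 (kappa : R) (S0 : {set T}) :
  (s <= k)%N -> (s <= #|T|)%N ->
  (forall S : {set T}, #|S| = s -> \sum_(B : {set T} | S \subset B) h B = kappa) ->
  \sum_B h B = 0 -> (#|S0| <= s)%N ->
  \sum_(B : {set T} | S0 \subset B) h B = 0.
Proof.
move=> lesk lesT Hk H0 le0.
have C_eq0 (m : nat) (x : R) : (m <= s)%N -> 'C(k - m, s - m)%:R * x = 0 -> x = 0.
  move=> lems /eqP; rewrite mulf_eq0 pnatr_eq0 => /orP[|/eqP //].
  by rewrite -leqn0 leqNgt bin_gt0 leq_sub2r.
have sumE (U : {set T}) :
    \sum_(S : {set T} | (U \subset S) && (#|S| == s))
       \sum_(B : {set T} | S \subset B) h B =
    kappa *+ #|[set S : {set T} | (U \subset S) && (#|S| == s)]|.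
  rewrite (eq_bigr (fun _ => kappa)) => [|S /andP[_ /eqP]]; last exact: Hk.
  by rewrite sumr_const; congr (_ *+ _); apply: eq_card => S; rewrite !inE.
have kappa0 : kappa = 0.
  have := superset_sum_double_count set0; rewrite cards0 => /(_ isT).
  under [X in _ = _ * X -> _]eq_bigl do rewrite sub0set.
  rewrite H0 mulr0 sumE.
  have -> : #|[set S : {set T} | (set0 \subset S) && (#|S| == s)]| = 'C(#|T|, s).
    by rewrite -card_draws; apply: eq_card => S; rewrite !inE sub0set.
  by move/eqP; rewrite mulrn_eq0 -leqn0 leqNgt bin_gt0 lesT => /eqP.
apply: (C_eq0 #|S0|) => //.
by rewrite -superset_sum_double_count // sumE kappa0 mul0rn.
Qed.

End SupersetSums.

(** Expand the product over all [i] of [1 - [i \in Z :&: B]]: a point of the intersection makes a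
    factor vanish, and otherwise every factor is 1. *)
Lemma disjoint_inclusion_exclusion (R : comNzRingType) (T : finType) (Z B : {set T}) :
  [disjoint Z & B]%:R
  = \sum_(S : {set T} | S \subset Z) (-1) ^+ #|S| * (S \subset B)%:R :> R.
Proof.
rewrite -setI_eq0.
transitivity (\prod_i (- (i \in Z :&: B)%:R + 1 : R)).
  have [->|[i iZB]] := set_0Vmem (Z :&: B).
    by rewrite eqxx big1 // => i _; rewrite inE oppr0 add0r.
  rewrite (bigD1 i) //= iZB addNr mul0r.
  by case: eqP iZB => // ->; rewrite inE.
rewrite bigA_distr [RHS]big_mkcond /=; apply: eq_bigr => S _.
rewrite -big_mkcond /= prodrN.
have -> : \prod_(i in S) (i \in Z :&: B)%:R = (S \subset Z :&: B)%:R :> R.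
  have [/subsetP sS|/subsetPn[i iS /negPf niZB]] := boolP (S \subset Z :&: B).
    by rewrite big1 // => i /sS ->.
  by rewrite (bigD1 i) //= niZB mul0r.
by rewrite subsetI; case: (S \subset Z) => //=; rewrite mulr0.
Qed.

(** The summand with [~: B] stands for the complementary block, so both families are averaged at
    once by sums over [k]-sets alone. *)
Lemma even_design_complement_average (R : numFieldType) (T : finType)
    (s n k lam : nat) (Bs : {set {set T}}) (Z : {set T}) :
  combinatorial_design s n k lam Bs -> ~~ odd s -> (#|Z| <= s.+1)%N ->
  \sum_(B in Bs) ((Z \subset B)%:R + (Z \subset ~: B)%:R)
  = #|Bs|%:R / 'C(n, k)%:R
    * \sum_(B : {set T} | #|B| == k) ((Z \subset B)%:R + (Z \subset ~: B)%:R) :> R.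
Proof.
case=> cT /andP[lesk lekn] cB desB evs leZ.
set a := _ / _; pose phi (B : {set T}) : R := (Z \subset B)%:R + (Z \subset ~: B)%:R.
change (\sum_(B in Bs) phi B = a * \sum_(B : {set T} | #|B| == k) phi B).
pose h (B : {set T}) : R := (B \in Bs)%:R - a * (#|B| == k)%:R.
have sum_h (F : {set T} -> R) (P : pred {set T}) :
    \sum_(B | P B) h B * F B = \sum_(B in Bs | P B) F B
      - a * \sum_(B : {set T} | (#|B| == k) && P B) F B.
  rewrite mulr_sumr !big_mkcondl -sumrB; apply: eq_bigr => B _.
  by rewrite /h mulrBl -mulrA; case: (B \in Bs); case: (_ == k);
    rewrite ?mul1r ?mul0r ?mulr0.
apply/eqP; rewrite -subr_eq0; apply/eqP.
have <- : \sum_B h B * phi B =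
    \sum_(B in Bs) phi B - a * \sum_(B : {set T} | #|B| == k) phi B.
  by rewrite (sum_h phi predT); congr (_ - a * _); apply: eq_bigl => B; rewrite andbT.
have C0 : 'C(n, k)%:R != 0 :> R by rewrite pnatr_eq0 -lt0n bin_gt0.
have hk (B : {set T}) : #|B| != k -> h B = 0.
  move=> nk; rewrite /h (negPf nk) mulr0 subr0.
  by case: (boolP (B \in Bs)) => // /cB /eqP; rewrite (negPf nk).
(* The inserted factor 1 lets [sum_h] turn sums of [h] into cardinalities. *)
have h1 (P : pred {set T}) : \sum_(B | P B) h B = \sum_(B | P B) h B * 1.
  by apply: eq_bigr => B _; rewrite mulr1.
(* The constant is the number of blocks through an [s]-set minus [a] times the number of [k]-sets
   through it; that it is zero comes out of [superset_sum_eq0]. *)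
have H0 (S : {set T}) : (#|S| <= s)%N -> \sum_(B : {set T} | S \subset B) h B = 0.
  apply: (@superset_sum_eq0 R T s k h hk (lam%:R - a * 'C(n - s, k - s)%:R)) => //.
  - by rewrite cT (leq_trans lesk).
  - move=> U cU; rewrite h1 sum_h !sumr_const; congr (_%:R - a * _%:R).
      by rewrite -(desB U cU); apply: eq_card => B; rewrite !inE.
    rewrite -cT -cU -cardsT -card_draws_between ?subsetT ?cU //.
    by apply: eq_card => B; rewrite !inE subsetT /in_mem /= andbC.
  (* The density [a] was chosen to make this total vanish. *)
  - rewrite h1 sum_h !sumr_const.
    have -> : #|[pred B in Bs | predT B]| = #|Bs|.
      by apply: eq_card => B; rewrite !inE andbT.
    have -> : #|[pred B : {set T} | (#|B| == k) && predT B]| = 'C(n, k).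
      by rewrite -cT -card_draws; apply: eq_card => B; rewrite !inE /in_mem /= andbT.
    by rewrite /a divfK ?subrr.
transitivity (\sum_(B : {set T} | Z \subset B) h B
   + \sum_(S : {set T} | S \subset Z) (-1) ^+ #|S| * \sum_(B : {set T} | S \subset B) h B).
  under eq_bigr do rewrite mulrDr.
  rewrite big_split /=; congr (_ + _).
    by rewrite [RHS]big_mkcond; apply: eq_bigr => B _; case: ifP; rewrite ?mulr1 ?mulr0.
  under [RHS]eq_bigr do rewrite big_mkcond mulr_sumr /=.
  rewrite exchange_big /=; apply: eq_bigr => B _.
  rewrite -disjoints_subset disjoint_inclusion_exclusion mulr_sumr.
  by apply: eq_bigr => S _; case: ifP; rewrite ?mulr1 ?mulr0 // mulrC.
(* Proper subsets of [Z] have at most [s] points, so only the term [S = Z] survives. *)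
rewrite [X in _ + X](bigD1 Z) //= [X in _ + (_ + X)]big1 ?addr0; last first.
  move=> S /andP[sSZ nSZ]; rewrite H0 ?mulr0 // -ltnS.
  by rewrite (leq_trans _ leZ) // proper_card // properEneq nSZ.
move: leZ; rewrite leq_eqVlt => /orP[/eqP cZ|/H0 ->]; last by rewrite mulr0 addr0.
by rewrite cZ -signr_odd /= evs expr1 mulN1r subrr.
Qed.

Lemma ones_bij (n : nat) : bijective (@ones n).
Proof.
exists (fun B : {set 'I_n} => [ffun i => i \in B] : hamming_point n) => [x|B].
  by apply/ffunP => i; rewrite ffunE inE.
by apply/setP => i; rewrite inE ffunE.
Qed.

Lemma sum_ones (R : nmodType) (n : nat) (P : pred {set 'I_n}) (F : {set 'I_n} -> R) :
  \sum_(x : hamming_point n | P (ones x)) F (ones x) = \sum_(B | P B) F B.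
Proof. by rewrite [RHS](reindex (@ones n)) //=; apply/onW_bij/ones_bij. Qed.

Lemma sum_setC (R : nmodType) (T : finType) (P : pred {set T}) (F : {set T} -> R) :
  \sum_(B : {set T} | P (~: B)) F (~: B) = \sum_(B | P B) F B.
Proof.
by rewrite [RHS](reindex (@setC T)) //=; apply/onW_bij/inv_bij/setCK.
Qed.

Lemma complementary_blocksE (T : finType) (Bs : {set {set T}}) (B : {set T}) :
  (B \in complementary_blocks Bs) = (~: B \in Bs).
Proof.
apply/imsetP/idP => [[C CB ->]|CB]; first by rewrite setCK.
by exists (~: B); rewrite ?setCK.
Qed.

Theorem theorem3p5 (R : realType) (n e r lam : nat)
    (Br : {set {set 'I_n}}) (c : R) (w : hamming_point n -> R)
    (he : (1 <= e)%N)
    (hdesign : combinatorial_design (2 * e) n r lam Br)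
    (hr : r <> (n - r)%N)
    (hc : 0 < c)
    (hw : forall y : hamming_point n,
        y \in points_of_blocks (Br :|: complementary_blocks Br) -> w y = c) :
  relative_design (2 * e + 1) [:: r; (n - r)%N]
    (points_of_blocks (Br :|: complementary_blocks Br)) w.
Proof.
have [_ /andP[_ lern] cB _] := hdesign.
set Y := points_of_blocks _ in hw *.
have YE (x : hamming_point n) : (x \in Y) = (ones x \in Br) || (~: ones x \in Br).
  by rewrite !inE complementary_blocksE.
have cardC (B : {set 'I_n}) : #|~: B| = (n - #|B|)%N by rewrite cardsCs setCK card_ord.
have cardCk (B : {set 'I_n}) : (#|~: B| == r) = (#|B| == (n - r)%N).
  have := max_card (mem B); rewrite card_ord cardC => leB.
  by apply/eqP/eqP => [<-|->]; rewrite subKn.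
(* Here [hr] enters: the shells are disjoint, so each one meets exactly one of the two block
   families. *)
have YrE (x : hamming_point n) : (x \in Y :&: shell n r) = (ones x \in Br).
  rewrite inE YE inE; case: (boolP (ones x \in Br)) => [/cB -> //|_]; first by rewrite eqxx.
  apply/andP => -[/cB/eqP]; rewrite cardCk => /eqP-> /eqP E; exact/hr/esym.
have YnrE (x : hamming_point n) : (x \in Y :&: shell n (n - r)) = (~: ones x \in Br).
  rewrite inE YE inE -cardCk orbC.
  case: (boolP (~: ones x \in Br)) => [/cB -> //|_]; first by rewrite eqxx.
  by apply/andP => -[/cB E]; rewrite cardCk E => /eqP.
split.
- by rewrite /= inE andbT; split=> [|i]; [apply/eqP | rewrite !inE => /orP[]/eqP->; rewrite ?leq_subr].
- rewrite !big_cons big_nil setU0; apply/subsetP => x xY.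
  rewrite in_setU; move: (xY); rewrite YE -YrE -YnrE.
  by case/orP; rewrite in_setI => /andP[_ ->]; rewrite ?orbT.
- by move=> y /hw ->.
move=> j z /andP[_ lej] zj; set Z := ones z.
have cZ : (#|Z| <= (2 * e).+1)%N by move: zj; rewrite inE -addn1 => /eqP ->.
have := @even_design_complement_average R _ _ _ _ _ _ Z hdesign.
rewrite oddM /= => /(_ isT cZ) avg.
rewrite !big_cons big_nil addr0.
have shellE k : #|shell n k| = 'C(n, k).
  rewrite -[in RHS](card_ord n) -card_draws -!sum1_card.
  under eq_bigl do rewrite inE.
  under [RHS]eq_bigl do rewrite inE.
  exact: (@sum_ones nat n (fun B => #|B| == k) (fun=> 1%N)).
have zetaE k : \sum_(x in shell n k) zeta R z x
    = \sum_(B : {set 'I_n} | #|B| == k) (Z \subset B)%:R.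
  under eq_bigl do rewrite inE.
  exact: (sum_ones _ _ (fun B => #|B| == k) (fun B => (Z \subset B)%:R)).
(* Complementation carries the second shell back to [r]-sets, matching the second summand of
   [avg]. *)
have zetaCE : \sum_(x in shell n (n - r)) zeta R z x
    = \sum_(B : {set 'I_n} | #|B| == r) (Z \subset ~: B)%:R.
  rewrite zetaE -sum_setC; apply: eq_bigl => B.
  by rewrite -cardCk setCK.
have sumYr (F : {set 'I_n} -> R) :
    \sum_(y in Y :&: shell n r) w y * F (ones y) = c * \sum_(B in Br) F B.
  rewrite mulr_sumr -(sum_ones _ _ (mem Br)); apply: eq_big => y; first by rewrite YrE.
  by rewrite inE => /andP[/hw ->].
have sumYnr (F : {set 'I_n} -> R) :
    \sum_(y in Y :&: shell n (n - r)) w y * F (ones y) = c * \sum_(B in Br) F (~: B).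
  rewrite mulr_sumr -sum_setC.
  under [RHS]eq_bigr do rewrite setCK.
  rewrite -(sum_ones _ _ (fun B => ~: B \in Br)); apply: eq_big => y; first by rewrite YnrE.
  by rewrite inE => /andP[/hw ->].
have -> : \sum_(y in Y :&: shell n r) w y = c * #|Br|%:R.
  have := sumYr (fun=> 1); rewrite sumr_const => <-.
  by apply: eq_bigr => y _; rewrite mulr1.
have -> : \sum_(y in Y :&: shell n (n - r)) w y = c * #|Br|%:R.
  have := sumYnr (fun=> 1); rewrite sumr_const => <-.
  by apply: eq_bigr => y _; rewrite mulr1.
(* Both shells have size ['C(n, r)] and weight [c * #|Br|], so a common density factors out and
   [avg] applies. *)
rewrite !shellE bin_sub // zetaE zetaCE -mulrDr -big_split /=.
have -> : \sum_(y in Y) w y * zeta R z y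
    = \sum_(y in Y :&: shell n r) w y * (Z \subset ones y)%:R
      + \sum_(y in Y :&: shell n (n - r)) w y * (Z \subset ones y)%:R.
  rewrite (bigID (mem (shell n r))) /=; congr (_ + _); apply: eq_bigl => y.
    by rewrite in_setI.
  (* A point of [Y] outside the first shell must come from a complementary block. *)
  rewrite YnrE YE; case: (boolP (~: ones y \in Br)) => [/cB/eqP|_].
    rewrite orbT /= cardCk inE => /eqP ->; apply/eqP; exact/nesym.
  by rewrite orbF inE; case: (boolP (ones y \in Br)) => //= /cB ->; rewrite eqxx.
rewrite (sumYr (fun B => (Z \subset B)%:R)) (sumYnr (fun B => (Z \subset B)%:R)) -mulrDr -big_split /= avg.
by rewrite !mulrA.
Qed.
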